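(* Let $k$ be a field. The assignment sending a graph $E$ to its Leavitt path algebra $L_k(E)$ and sending a morphism $f$ from $E$ to $F$ in $RMIPG$ to the map $f_*^L\colon L_k(E)\to L_k(F)$ determined by $$f_*^L([\chi_p])=[\chi_{\bar f(p)}]\quad\text{for all }p\in FP(\bar E),$$ defines a covariant functor from $RMIPG$ to the category $KA$ of $k$-algebras and algebra homomorphisms. Furthermore, the same assignment restricted to the subcategory $RMBPG$ yields a covariant functor to the category $UKA$ of unital $k$-algebras and unital algebra homomorphisms.
   Context: Graphs. A graph $E=(E^0,E^1,s_E,t_E)$ consists of a set $E^0$ of vertices, a set $E^1$ of edges, and source and target maps $s_E,t_E\colon E^1\to E^0$. A vertex $v$ is regular if $0<|s_E^{-1}(v)|<\infty$; $\mathrm{reg}(E)$ is the set of regular vertices. $\mathrm{reg}_0(E)$ is the set of $v\in\mathrm{reg}(E)$ with $s_E^{-1}(v)=\{e\}$ and $t_E(e)=v$. A finite path is a vertex (length $0$) or a finite sequence $e_1\ldots e_n$ ($n\ge1$) of edges with $t_E(e_i)=s_E(e_{i+1})$. $FP(E)$ is the set of finite paths; $s_{PE},t_{PE}\colon FP(E)\to E^0$ are the beginning and end maps (a vertex begins and ends at itself). Path homomorphisms. A path homomorphism from $E$ to $F$ is a map $f\colon FP(E)\to FP(F)$ with $f(E^0)\subseteq F^0$, $s_{PF}\circ f=f\circ s_{PE}$, $t_{PF}\circ f=f\circ t_{PE}$, and $f(pq)=f(p)f(q)$ whenever $t_{PE}(p)=s_{PE}(q)$. For finite paths write $\alpha\preceq\beta$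 iff $\beta=\alpha\gamma$ for some finite path $\gamma$. $f$ is regular if: (1) for every $v\in\mathrm{reg}(E)\setminus\mathrm{reg}_0(E)$: (a) $f$ restricted to $s_E^{-1}(v)$ is injective; (b) $p\in f(s_E^{-1}(v))$ if and only if all of the following hold: (i) $p=e_1\ldots e_n$ with $n\ge1$ and all $e_i\in F^1$; (ii) $pq\in f(s_E^{-1}(v))$ implies $q=t_{PF}(p)$; (iii) for all $i\in\{1,\ldots,n\}$ and all $e\in s_F^{-1}(s_F(e_i))$ there is $r\in FP(F)$ with $e_1\ldots e_{i-1}er\in f(s_E^{-1}(v))$; (2) for every $v\in\mathrm{reg}_0(E)$, either the condition in (1) holds at $v$ or $f(s_E^{-1}(v))=\{f(v)\}$. $RMIPG$ is the category whose objects are graphs and whose morphisms are the path homomorphisms that are injective on vertices, satisfy the monotonicity condition ($f(e)\preceq f(e')\Rightarrow e=e'$ for all edges $e,e'$), and are regular. $RMBPG$ is its subcategory whose objects are graphs with finitely many vertices and whose morphisms are those morphisms of $RMIPG$ that are bijective on vertices. Algebras. The path algebra $kE$ is the $k$-vector space with basis $\{\chi_p\}_{p\in FP(E)}$ and multiplication $\chi_p\chi_q=\chi_{pq}$ if $t_{PE}(p)=s_{PE}(q)$ and $0$ otherwise ($kE=0$ if $E=\emptyset$). The extended graph $\bar E$ has $\bar E^0=E^0$, $\bar E^1=E^1\sqcup\{e^*\mid e\in E^1\}$, with $s_{\bar E}(e)=s_E(e)$, $t_{\bar E}(e)=t_E(e)$, $s_{\bar E}(e^* )=t_E(e)$, $t_{\bar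 E}(e^* )=s_E(e)$. For $p=e_1\ldots e_n\in FP(E)$, $p^*:=e_n^*\ldots e_1^*\in FP(\bar E)$, and $v^*:=v$ for a vertex $v$. The Leavitt path algebra $L_k(E)$ is the quotient of $k\bar E$ by the ideal generated by $\chi_{e^*}\chi_{e'}-\delta_{e,e'}\chi_{t_E(e)}$ for $e,e'\in E^1$ and $\sum_{e\in s_E^{-1}(v)}\chi_e\chi_{e^*}-\chi_v$ for $v\in\mathrm{reg}(E)$; $[\cdot]$ denotes classes in the quotient. For a path homomorphism $f$ from $E$ to $F$, $\bar f\colon FP(\bar E)\to FP(\bar F)$ is the path homomorphism with $\bar f(v)=f(v)$, $\bar f(e)=f(e)$, $\bar f(e^* )=f(e)^*$ for $v\in E^0$, $e\in E^1$, and $\bar f(x_1\ldots x_n)=\bar f(x_1)\ldots\bar f(x_n)$ for $x_i\in\bar E^1$. *)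

(* Defs.v *)
From HB Require Import structures.
From mathcomp Require Import all_boot all_order all_algebra.
From mathcomp Require Import finmap multinomials.monalg.
From mathcomp Require Import boolp classical_sets functions cardinality fsbigop.

Set Implicit Arguments.
Unset Strict Implicit.
Unset Printing Implicit Defensive.

Import GRing.Theory.
Local Open Scope classical_set_scope.
Local Open Scope ring_scope.

Record category := Category {
  ob :> Type;
  arrow : ob -> ob -> Type;
  id_arrow : forall x, arrow x x;
  compose : forall x y z, arrow y z -> arrow x y -> arrow x z;
  comp1m : forall x y (f : arrow x y), compose (id_arrow y) f = f;
  compm1 : forall x y (f : arrow x y), compose f (id_arrow x) = f;
  compmA : forall x y z t (h : arrow z t) (g : arrow y z) (f : arrow x y),
    compose h (compose g f) = compose (compose h g) f
}.
Arguments arrow {_} _ _.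
Arguments id_arrow {_} _.
Arguments compose {_ _ _ _} _ _.

(* A covariant functor whose action on objects is the prescribed map [Fob]. *)
Record functor (C D : category) (Fob : C -> D) := Functor {
  fmor : forall x y : C, arrow x y -> arrow (Fob x) (Fob y);
  fmor_id : forall x, fmor (id_arrow x) = id_arrow (Fob x);
  fmor_comp : forall x y z (g : arrow y z) (f : arrow x y),
    fmor (compose g f) = compose (fmor g) (fmor f)
}.
Arguments fmor {C D Fob} _ {x y} _.

Section Subcategory.
Variables (C : category) (P : C -> Prop).
Variable Q : forall x y : C, arrow x y -> Prop.
Hypothesis Q1 : forall x, P x -> Q (id_arrow x).
Hypothesis QM : forall x y z (g : arrow y z) (f : arrow x y),
  Q g -> Q f -> Q (compose g f).

Definition subcategory : category.
Proof.
refine (@Category {x : C | P x}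
  (fun x y => {f : arrow (sval x) (sval y) | Q f})
  (fun x => exist _ (id_arrow (sval x)) (Q1 (svalP x)))
  (fun x y z g f =>
     exist _ (compose (sval g) (sval f)) (QM (svalP g) (svalP f)))
  _ _ _).
- by move=> x y [f Qf]; apply: eq_exist; exact: comp1m.
- by move=> x y [f Qf]; apply: eq_exist; exact: compm1.
- by move=> x y z t [h Qh] [g Qg] [f Qf]; apply: eq_exist; exact: compmA.
Defined.

End Subcategory.

Record graph := Graph {
  vert : Type;
  edge : Type;
  src : edge -> vert;
  tgt : edge -> vert
}.
Arguments src {_} _.
Arguments tgt {_} _.

(* Classical equality and choice, so that edges can index finite sums. *)
HB.instance Definition _ (E : graph) := gen_eqMixin (edge E).
HB.instance Definition _ (E : graph) := gen_choiceMixin (edge E).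

Section Paths.
Variable E : graph.

Definition out (v : vert E) : set (edge E) := [set e | src e = v].

Definition reg (v : vert E) : Prop := finite_set (out v) /\ out v !=set0.

Definition reg0 (v : vert E) : Prop :=
  reg v /\ exists e, out v = [set e] /\ tgt e = v.

Fixpoint is_path (v : vert E) (s : seq (edge E)) : Prop :=
  if s is e :: s' then src e = v /\ is_path (tgt e) s' else True.

(* [fsrc] is redundant when [fedges] is not empty; the path of length 0 at [v]
   has [fsrc := v] and no edges. *)
Record FP := FPath {
  fsrc : vert E;
  fedges : seq (edge E);
  fpathP : is_path fsrc fedges
}.

HB.instance Definition _ := gen_eqMixin FP.
HB.instance Definition _ := gen_choiceMixin FP.

Definition ftgt (p : FP) : vert E := last (fsrc p) (map tgt (fedges p)).

Definition flen (p : FP) : nat := size (fedges p).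

Definition vpath (v : vert E) : FP := @FPath v [::] I.

Definition epath (e : edge E) : FP := @FPath (src e) [:: e] (conj erefl I).

Lemma fpath_eq (p q : FP) : fsrc p = fsrc q -> fedges p = fedges q -> p = q.
Proof.
case: p q => v s Hs [w t Ht] /= vw st; subst w t.
by rewrite (Prop_irrelevance Hs Ht).
Qed.

Lemma is_path_cat v s t : is_path v (s ++ t) <->
  is_path v s /\ is_path (last v (map tgt s)) t.
Proof.
elim: s v => [|e s IH] v /=; first by split=> // -[].
rewrite IH; tauto.
Qed.

Lemma fcat_subproof (p q : FP) :
  ftgt p = fsrc q -> is_path (fsrc p) (fedges p ++ fedges q).
Proof.
move=> pq; apply/is_path_cat; split; first exact: fpathP.
by rewrite -/(ftgt p) pq; exact: fpathP.
Qed.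

(* Concatenation; the value is meaningful only if [ftgt p = fsrc q]. *)
Definition fcat (p q : FP) : FP :=
  if pselect (ftgt p = fsrc q) is left pq then FPath (fcat_subproof pq) else p.

End Paths.

Notation "p ⋅ q" := (fcat p q) (at level 40, left associativity).

Section PathTheory.
Variable E : graph.
Implicit Types p q r : FP E.

Lemma fsrc_cat p q : fsrc (p ⋅ q) = fsrc p.
Proof. by rewrite /fcat; case: pselect. Qed.

Lemma fedges_cat p q : ftgt p = fsrc q -> fedges (p ⋅ q) = fedges p ++ fedges q.
Proof. by rewrite /fcat; case: pselect. Qed.

Lemma ftgt_cat p q : ftgt p = fsrc q -> ftgt (p ⋅ q) = ftgt q.
Proof.
move=> pq; rewrite /ftgt fedges_cat// map_cat last_cat fsrc_cat.
by rewrite -/(ftgt p) pq.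
Qed.

Lemma fcatA p q r : ftgt p = fsrc q -> ftgt q = fsrc r ->
  p ⋅ (q ⋅ r) = p ⋅ q ⋅ r.
Proof.
move=> pq qr; apply: fpath_eq; first by rewrite !fsrc_cat.
by rewrite !fedges_cat ?fsrc_cat ?ftgt_cat// catA.
Qed.

Lemma fcatv p : p ⋅ vpath (ftgt p) = p.
Proof. by apply: fpath_eq; rewrite ?fsrc_cat ?fedges_cat ?cats0. Qed.

Lemma fvcat p : vpath (fsrc p) ⋅ p = p.
Proof. by apply: fpath_eq; rewrite ?fsrc_cat ?fedges_cat. Qed.

Lemma flen0_vpath p : flen p = 0%N -> p = vpath (fsrc p).
Proof. by move=> /size0nil p0; exact: fpath_eq. Qed.

Lemma fsrc_edges p e s : fedges p = e :: s -> fsrc p = src e.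
Proof. by move=> ps; move: (fpathP p); rewrite ps => -[]. Qed.

Lemma fpath_split p s1 e s2 : fedges p = s1 ++ e :: s2 ->
  exists p1 p2, [/\ ftgt p1 = src e, fsrc p2 = tgt e, fedges p1 = s1,
                    fedges p2 = s2 & p = p1 ⋅ epath e ⋅ p2].
Proof.
move=> ps; have := fpathP p; rewrite ps => /is_path_cat[H1 /= [H2 H3]].
pose p1 := FPath H1; pose p2 := FPath H3.
have h1 : ftgt p1 = src e by [].
exists p1, p2; split=> //; apply: fpath_eq; first by rewrite !fsrc_cat.
by rewrite ps fedges_cat ?ftgt_cat// fedges_cat//= -catA.
Qed.

End PathTheory.

Definition prec (E : graph) (p q : FP E) : Prop :=
  exists2 r, ftgt p = fsrc r & q = p ⋅ r.

Record path_hom (E F : graph) := PathHom {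
  ph_fun :> FP E -> FP F;
  ph_vert : forall v, exists w, ph_fun (vpath v) = vpath w;
  ph_src : forall p, vpath (fsrc (ph_fun p)) = ph_fun (vpath (fsrc p));
  ph_tgt : forall p, vpath (ftgt (ph_fun p)) = ph_fun (vpath (ftgt p));
  ph_cat : forall p q, ftgt p = fsrc q -> ph_fun (p ⋅ q) = ph_fun p ⋅ ph_fun q
}.

Section PathHom.
Variables E F : graph.
Implicit Type f : path_hom E F.

(* The map on vertices induced by [f]. *)
Definition vmap f (v : vert E) : vert F := fsrc (f (vpath v)).

Lemma ph_vpath f v : f (vpath v) = vpath (vmap f v).
Proof. by rewrite /vmap; have [w ->] := ph_vert f v. Qed.

Lemma ph_fsrc f p : fsrc (f p) = vmap f (fsrc p).
Proof. by rewrite /vmap -ph_src. Qed.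

Lemma ph_ftgt f p : ftgt (f p) = vmap f (ftgt p).
Proof. by rewrite /vmap -ph_tgt. Qed.

Lemma path_hom_eq f g : ph_fun f = ph_fun g -> f = g.
Proof.
case: f g => f a b c d [g a' b' c' d'] /= fg; subst g.
by rewrite (Prop_irrelevance a a') (Prop_irrelevance b b')
  (Prop_irrelevance c c') (Prop_irrelevance d d').
Qed.

Definition edge_image f (v : vert E) : set (FP F) :=
  [set f (epath e) | e in out v].

(* In the last clause, the decompositions of [p = e_1 ... e_n] as
   [p1 ⋅ epath e ⋅ p2] correspond to the indices i, with [e = e_i] and
   [p1 = e_1 ... e_(i-1)]. *)
Definition regular_at f (v : vert E) : Prop :=
  set_inj (out v) (fun e => f (epath e)) /\
  forall p : FP F, edge_image f v p <->
    [/\ (1 <= flen p)%N,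
        forall q, ftgt p = fsrc q -> edge_image f v (p ⋅ q) ->
          q = vpath (ftgt p)
      & forall p1 e p2, ftgt p1 = src e -> fsrc p2 = tgt e ->
          p = p1 ⋅ epath e ⋅ p2 ->
          forall e', out (src e) e' ->
          exists2 r, fsrc r = tgt e' & edge_image f v (p1 ⋅ epath e' ⋅ r)].

Definition ph_regular f : Prop :=
  (forall v, reg v -> ~ reg0 v -> regular_at f v) /\
  (forall v, reg0 v -> regular_at f v \/ edge_image f v = [set f (vpath v)]).

Definition ph_monotone f : Prop :=
  forall e e', prec (f (epath e)) (f (epath e')) -> e = e'.

End PathHom.

Section PathHomComp.
Variables E F G : graph.

Definition path_id : path_hom E E.
Proof. by refine (@PathHom E E id _ _ _ _) => // v; exists v. Defined.

Definition path_comp (g : path_hom F G) (f : path_hom E F) : path_hom E G.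
Proof.
refine (@PathHom E G (g \o f) _ _ _ _).
- by move=> v; exists (vmap g (vmap f v)); rewrite /= !ph_vpath.
- by move=> p; rewrite /= !ph_vpath !ph_fsrc.
- by move=> p; rewrite /= !ph_vpath !ph_ftgt.
- by move=> p q pq; rewrite /= !ph_cat// ph_ftgt ph_fsrc pq.
Defined.

Lemma vmap_comp (g : path_hom F G) (f : path_hom E F) v :
  vmap (path_comp g f) v = vmap g (vmap f v).
Proof. by rewrite /vmap /= ph_vpath. Qed.

End PathHomComp.

Record RMIPG_hom (E F : graph) := RMIPGHom {
  rm_path :> path_hom E F;
  rm_inj : injective (vmap rm_path);
  rm_mono : ph_monotone rm_path;
  rm_reg : ph_regular rm_path
}.

Lemma RMIPG_hom_eq E F (f g : RMIPG_hom E F) : f = g :> (FP E -> FP F) -> f = g.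
Proof.
case: f g => f a b c [g a' b' c'] /= /path_hom_eq fg; subst g.
by rewrite (Prop_irrelevance a a') (Prop_irrelevance b b')
  (Prop_irrelevance c c').
Qed.


Section Regularity.
Variables E F : graph.
Implicit Type f : path_hom E F.

Lemma prec_refl (p : FP F) : prec p p.
Proof. by exists (vpath (ftgt p)); rewrite ?fcatv. Qed.

Lemma precP (p q : FP F) : prec p q <->
  fsrc p = fsrc q /\ exists s, fedges q = fedges p ++ s.
Proof.
split=> [[r pr ->]|[pq [s qs]]].
  by rewrite fsrc_cat fedges_cat//; split=> //; exists (fedges r).
have := fpathP q; rewrite -pq qs => /is_path_cat[_ Hs].
by exists (FPath Hs) => //; apply: fpath_eq; rewrite ?fsrc_cat ?fedges_cat.
Qed.

(* For monotone maps, regularity amounts to positive lengths and branching. *)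
Lemma regular_at_intro f v : ph_monotone f ->
  (forall e, out v e -> (1 <= flen (f (epath e)))%N) ->
  (forall e0 s1 e s2 e', out v e0 -> fedges (f (epath e0)) = s1 ++ e :: s2 ->
     src e' = src e -> exists2 x, out v x &
       exists s3, fedges (f (epath x)) = s1 ++ e' :: s3) ->
  regular_at f v.
Proof.
move=> mf lf bf; split=> [e e' _ _ /= ee'|p].
  by apply: mf; rewrite ee'; exact: prec_refl.
split=> [[e ev <-]|[p1 H2 H3]].
  split; first exact: lf.
    move=> q eq [e' e'v e'q]; have ee' : e = e' by apply: mf; exists q.
    subst e'; move: e'q => /(congr1 (@fedges F)); rewrite fedges_cat// => qs.
    apply: fpath_eq => //=; apply: size0nil.
    by move: qs => /(congr1 size)/eqP; rewrite size_cat -[X in X == _]addn0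
      eqn_add2l => /eqP.
  move=> q1 e1 q2 h1 h2 /[dup] /(congr1 (@fsrc F)) + /(congr1 (@fedges F)).
  rewrite !fsrc_cat !fedges_cat ?ftgt_cat//= -catA/= => s1 es e' e'1.
  have [x xv [s3 xs]] := bf _ _ _ _ _ ev es e'1.
  have [r1 [r2 [k1 k2 r1s r2s xr]]] := fpath_split xs.
  have r1q1 : r1 = q1.
    apply: fpath_eq; last by rewrite r1s.
    rewrite -s1 ph_fsrc/= ev -xv.
    by rewrite -[src x]/(fsrc (epath x)) -ph_fsrc xr !fsrc_cat.
  by exists r2 => //; exists x => //; rewrite xr r1q1.
have [s [e ps]] : exists s e, fedges p = rcons s e.
  by move: p1; rewrite /flen; case/lastP: (fedges p) => // s e; exists s, e.
rewrite -cats1 in ps.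
have [q1 [q2 [h1 h2 q1s q2s pq]]] := fpath_split ps.
have [r re] := H3 _ _ _ h1 h2 pq e erefl.
have q2v : q2 = vpath (ftgt (q1 ⋅ epath e)).
  by rewrite ftgt_cat//; apply: fpath_eq.
have {}pq : p = q1 ⋅ epath e by rewrite pq {1}q2v fcatv.
have pr : ftgt p = fsrc r by rewrite pq ftgt_cat.
rewrite -pq => Ap; rewrite -[p]fcatv -(H2 r pr Ap); exact: Ap.
Qed.

Lemma regular_at_len f v e : regular_at f v -> out v e ->
  (1 <= flen (f (epath e)))%N.
Proof.
move=> [_ rf] ev; have [] // := (rf (f (epath e))).1.
by exists e.
Qed.

Lemma regular_at_branch f v e0 s1 e s2 e' : regular_at f v ->
  out v e0 -> fedges (f (epath e0)) = s1 ++ e :: s2 -> src e' = src e ->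
  exists2 x, out v x & exists s3, fedges (f (epath x)) = s1 ++ e' :: s3.
Proof.
move=> [_ rf] ev es e'e.
have [|_ _ b] := (rf (f (epath e0))).1; first by exists e0.
have [p1 [p2 [h1 h2 p1s p2s pE]]] := fpath_split es.
have [r re' [x xv xE]] := b _ _ _ h1 h2 pE _ e'e.
exists x => //; exists (fedges r); rewrite xE.
by rewrite !fedges_cat ?ftgt_cat ?p1s -?catA//= e'e h1.
Qed.

(* Every edge leaving [src e] is the first edge after [s1] of the image of an
   edge leaving [v]. *)
Lemma regular_at_reg f v e0 s1 e s2 : reg v -> regular_at f v ->
  out v e0 -> fedges (f (epath e0)) = s1 ++ e :: s2 -> reg (src e).
Proof.
move=> [fv _] rf ev es; split; last by exists e.
apply: (@sub_finite_set _ _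
  ((fun x => nth e (fedges (f (epath x))) (size s1)) @` out v)); last first.
  exact: finite_image.
move=> e' e'e; have [x xv [s3 xs]] := regular_at_branch rf ev es e'e.
by exists x => //; rewrite xs nth_cat ltnn subnn.
Qed.

Lemma ph_cons f p e s : fedges p = e :: s ->
  exists q, [/\ fsrc q = tgt e, fedges q = s, p = epath e ⋅ q &
    fedges (f p) = fedges (f (epath e)) ++ fedges (f q)].
Proof.
move=> pes; have [q1 [q2 [h1 h2 q10 q2s ->]]] := @fpath_split _ p [::] e s pes.
have qe : q1 ⋅ epath e = epath e.
  have -> : q1 = vpath (fsrc (epath e)).
    by apply: fpath_eq => //=; rewrite -h1 /ftgt q10.
  exact: fvcat.
exists q2; split=> //; first by rewrite qe.
by rewrite qe ph_cat// fedges_cat// ph_ftgt ph_fsrc h2.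
Qed.

End Regularity.

Section RMIPGId.
Variable E : graph.

Lemma mono_id : ph_monotone (path_id E).
Proof. by move=> e e' /precP /= [_ [s []]]. Qed.

Lemma regular_id : ph_regular (path_id E).
Proof.
suff H v : regular_at (path_id E) v by split=> // v _; left.
apply: regular_at_intro => //; first exact: mono_id.
move=> e0 [|x s1] e s2 e' /= ev; last by case=> _; case: s1.
by case=> <- _ e'e; exists e'; [rewrite /out /= e'e|exists [::]].
Qed.

Lemma inj_id : injective (vmap (path_id E)).
Proof. by []. Qed.

Definition RMIPG_id : RMIPG_hom E E := RMIPGHom inj_id mono_id regular_id.

End RMIPGId.

Section RMIPGComp.
Variables E F G : graph.
Variables (g : RMIPG_hom F G) (f : RMIPG_hom E F).

Lemma inj_comp : injective (vmap (path_comp g f)).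
Proof.
by move=> v w; rewrite !vmap_comp => /(@rm_inj _ _ g)/(@rm_inj _ _ f).
Qed.

Lemma prec_reflect (p q : FP F) : prec (g p) (g q) -> prec p q \/ prec q p.
Proof.
move=> /precP[]; rewrite !ph_fsrc => /(@rm_inj _ _ g) + [t].
move ps : (fedges p) => s; elim: s p q ps => [|e s IH] p q ps pq gpq.
  by left; apply/precP; rewrite ps; split=> //; exists (fedges q).
case qs : (fedges q) => [|e' s'].
  by right; apply/precP; rewrite qs; split=> //; exists (fedges p).
have [p' [p'e p's pE gp]] := ph_cons g ps.
have [q' [q'e q's qE gq]] := ph_cons g qs.
have ee' : e = e'.
  have se : src e = src e' by rewrite -(fsrc_edges ps) pq (fsrc_edges qs).
  have [le|/ltnW le] := leqP (flen (g (epath e))) (flen (g (epath e'))).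
    apply: (@rm_mono _ _ g); apply/precP; rewrite !ph_fsrc/= se; split=> //.
    exists (drop (flen (g (epath e))) (fedges (g (epath e')))).
    have := congr1 (take (flen (g (epath e)))) gpq.
    rewrite gp gq -catA takel_cat// take_size_cat// => h.
    by rewrite -[LHS](cat_take_drop (flen (g (epath e)))) h.
  apply/esym/(@rm_mono _ _ g); apply/precP; rewrite !ph_fsrc/= se; split=> //.
  exists (drop (flen (g (epath e'))) (fedges (g (epath e)))).
  have := congr1 (take (flen (g (epath e')))) gpq.
  rewrite gp gq -catA take_size_cat// takel_cat// => h.
  by rewrite -[LHS](cat_take_drop (flen (g (epath e')))) -h.
subst e'.
have p'q' : fsrc p' = fsrc q' by rewrite p'e q'e.
have gpq' : fedges (g q') = fedges (g p') ++ t.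
  move: gpq; rewrite gp gq -catA => /eqP; rewrite eqseq_cat// => /andP[_].
  by move/eqP.
have [/precP[_ [u q'u]]|/precP[_ [u p'u]]] := IH _ _ p's p'q' gpq'.
  by left; apply/precP; split=> //; exists u; rewrite ps qs -p's -q's q'u.
by right; apply/precP; split=> //; exists u; rewrite ps qs -p's -q's p'u.
Qed.

Lemma mono_comp : ph_monotone (path_comp g f).
Proof.
by move=> e e' /= /prec_reflect[/(@rm_mono _ _ f)|/(@rm_mono _ _ f)].
Qed.

(* An edge of [g p] lies in the image of some edge of [p]. *)
Lemma ph_block (p : FP F) t1 x t2 : fedges (g p) = t1 ++ x :: t2 ->
  exists s1 e s2 u1 u2, [/\ fedges p = s1 ++ e :: s2,
    fedges (g (epath e)) = u1 ++ x :: u2 &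
    forall q s3, fsrc q = fsrc p -> fedges q = s1 ++ s3 ->
      exists r, [/\ fedges r = s3, fsrc r = last (fsrc p) (map tgt s1) &
      exists w, t1 = w ++ u1 /\ fedges (g q) = w ++ fedges (g r)]].
Proof.
move ps : (fedges p) => s; elim: s p ps t1 => [|e s IH] p ps t1 gp.
  have pv : p = vpath (fsrc p) by apply: flen0_vpath; rewrite /flen ps.
  by move: gp; rewrite pv ph_vpath /=; case: t1.
have [p' [p'e p's pE gpE]] := ph_cons g ps.
have [lt|le] := ltnP (size t1) (flen (g (epath e))).
  rewrite /flen in lt.
  exists [::], e, s, t1, (drop (size t1).+1 (fedges (g (epath e)))).
  split=> //; last first.
    by move=> q s3 qp qs; exists q; split=> //; exists [::].
  have := congr1 (drop (size t1)) gp.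
  rewrite drop_size_cat// gpE drop_cat lt => d.
  have := congr1 (take (size t1)) gp.
  rewrite take_size_cat// gpE takel_cat 1?ltnW// => tk.
  rewrite -[LHS](cat_take_drop (size t1)) tk; congr (_ ++ _).
  by move: d; rewrite (drop_nth x)// => -[-> _].
have gpE' : fedges (g p') = drop (flen (g (epath e))) t1 ++ x :: t2.
  have := congr1 (drop (flen (g (epath e)))) gp.
  rewrite gpE drop_size_cat// drop_cat => ->.
  by case: ltngtP le => // -> _; rewrite drop_size subnn drop0.
have tk : fedges (g (epath e)) = take (flen (g (epath e))) t1.
  have := congr1 (take (flen (g (epath e)))) gp.
  by rewrite gpE take_size_cat// takel_cat.
have [s1 [e1 [s2 [u1 [u2 [h1 h2 h3]]]]]] := IH _ p's _ gpE'.
exists (e :: s1), e1, s2, u1, u2; split=> //; first by rewrite h1.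
move=> q s3 qp qs.
have [q' [q'e q's qE gqE]] := ph_cons g qs.
have [|r [rs rv [w [w1 w2]]]] := h3 q' s3 _ q's; first by rewrite q'e p'e.
exists r; split=> //; first by rewrite rv /= p'e.
exists (fedges (g (epath e)) ++ w); split; last by rewrite gqE w2 catA.
by rewrite -catA -w1 tk cat_take_drop.
Qed.

Lemma branch_comp v e0 s1 e s2 e' : reg v -> regular_at f v -> out v e0 ->
  fedges (g (f (epath e0))) = s1 ++ e :: s2 -> src e' = src e ->
  exists2 x, out v x & exists s3, fedges (g (f (epath x))) = s1 ++ e' :: s3.
Proof.
move=> rv rf e0v gs e'e.
have [t1 [a [t2 [u1 [u2 [fs ga H]]]]]] := ph_block gs.
have ra : reg (src a) by exact: regular_at_reg rv rf e0v fs.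
have rg : regular_at g (src a).
  have [r0|nr0] := pselect (reg0 (src a)); last by exact: (rm_reg g).1.
  have [//|img] := (rm_reg g).2 _ r0.
  have : edge_image g (src a) (g (epath a)) by exists a.
  by rewrite img /= => gav; move: ga; rewrite gav ph_vpath; case: (u1).
have [b ba [u3 gb]] := regular_at_branch rg erefl ga e'e.
have [x xv [t3 fx]] := regular_at_branch rf e0v fs ba.
exists x => //.
have [|r [rs rsrc [w [-> ->]]]] := H _ _ _ fx.
  by rewrite !ph_fsrc/= e0v xv.
have [r' [_ _ _ ->]] := ph_cons g rs.
by rewrite gb; exists (u3 ++ fedges (g r')); rewrite -!catA.
Qed.

(* If [g] contracts [f e] to a vertex, then [e] is a loop and is the only edge
   leaving its source. *)
Lemma contract_loop v e : reg v -> regular_at f v -> out v e ->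
  flen (g (f (epath e))) = 0%N -> reg0 v.
Proof.
move=> rv rf ev gf0.
have loops s1 x s2 : fedges (f (epath e)) = s1 ++ x :: s2 ->
    out (src x) = [set x] /\ tgt x = src x.
  move=> fs; have rx := regular_at_reg rv rf ev fs.
  have gx0 : fedges (g (epath x)) = [::].
    have [p1 [p2 [h1 h2 _ _ pE]]] := fpath_split fs.
    move: gf0; rewrite pE ph_cat ?ftgt_cat// ph_cat//.
    rewrite /flen !fedges_cat ?ftgt_cat ?ph_ftgt ?ph_fsrc ?h1 ?h2//.
    by rewrite !size_cat; case: (fedges (g (epath x))) => // a l /eqP;
      rewrite addn_eq0 addnS.
  have [[_ [y [oy ty]]]|nr0] := pselect (reg0 (src x)).
    have xy : x = y by have : out (src x) x by []; rewrite oy.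
    by subst y; split.
  have := regular_at_len ((rm_reg g).1 _ rx nr0) (erefl : out (src x) x).
  by rewrite /flen gx0.
have back : ftgt (f (epath e)) = fsrc (f (epath e)).
  rewrite /ftgt.
  have : forall s1 s2, fedges (f (epath e)) = s1 ++ s2 ->
      last (fsrc (f (epath e))) (map tgt s1) = fsrc (f (epath e)).
    elim/last_ind=> [//|s1 x IH] s2; rewrite cat_rcons => fs.
    have [_ tx] := loops _ _ _ fs.
    rewrite map_rcons last_rcons tx -(IH _ fs).
    by move: (fpathP (f (epath e))); rewrite fs => /is_path_cat[_ [->]].
  by move=> /(_ (fedges (f (epath e))) [::]); apply; rewrite cats0.
have te : tgt e = v.
  by move: back; rewrite ph_ftgt ph_fsrc => /(@rm_inj _ _ f) h; rewrite -ev.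
split=> //; exists e; split=> //.
apply/seteqP; split=> [e' e'v|_ ->]; last exact: ev.
have : forall s1 s2 t1, fedges (f (epath e)) = s1 ++ s2 ->
    fedges (f (epath e')) = s1 ++ t1 ->
    prec (f (epath e)) (f (epath e')) \/ prec (f (epath e')) (f (epath e)).
  move=> s1 s2; elim: s2 s1 => [|x s2 IH] s1 t1 fs ft.
    left; apply/precP; rewrite !ph_fsrc/= ev e'v; split=> //.
    by exists t1; rewrite fs cats0.
  case: t1 ft => [|y t1] ft.
    right; apply/precP; rewrite !ph_fsrc/= ev e'v; split=> //.
    by exists (x :: s2); rewrite ft cats0.
  have xy : y = x.
    have [ox _] := loops _ _ _ fs.
    suff : out (src x) y by rewrite ox.
    have := fpathP (f (epath e)); rewrite fs => /is_path_cat[_ [sx _]].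
    have := fpathP (f (epath e')); rewrite ft => /is_path_cat[_ [sy _]].
    by rewrite /out /= sx sy !ph_fsrc/= ev e'v.
  by subst y; apply: (IH (rcons s1 x) t1); rewrite cat_rcons.
by move=> /(_ [::] _ _ erefl erefl) [] /(@rm_mono _ _ f).
Qed.

Lemma regular_comp : ph_regular (path_comp g f).
Proof.
split=> [v rv nr0|v r0].
  have rf := (rm_reg f).1 v rv nr0.
  apply: regular_at_intro; first exact: mono_comp.
    move=> e ev; rewrite lt0n; apply/eqP => e0.
    exact/nr0/(contract_loop rv rf ev e0).
  by move=> e0 s1 e s2 e'; exact: branch_comp.
have rv := r0.1.
have [_ [l [ol tl]]] := r0.
have imgE h : edge_image h v = [set h (epath l)] :> set (FP G).
  by rewrite /edge_image ol image_set1.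
have [rf|imf] := (rm_reg f).2 v r0.
  have [g0|g0] := posnP (flen (g (f (epath l)))).
    right; rewrite imgE; congr [set _]; rewrite /=.
    rewrite (flen0_vpath g0) !ph_fsrc !ph_vpath/=.
    by have : out v l by [rewrite ol]; move=> ->.
  left; apply: regular_at_intro; first exact: mono_comp.
    by move=> e; rewrite ol => ->.
  by move=> e0 s1 e s2 e'; exact: branch_comp.
right; rewrite imgE /=; congr [set g _].
have : edge_image f v (f (epath l)) by exists l => //; rewrite ol.
by rewrite imf.
Qed.

Definition RMIPG_comp : RMIPG_hom E G :=
  RMIPGHom inj_comp mono_comp regular_comp.

End RMIPGComp.

Definition RMIPG : category.
Proof.
by refine (@Category graph RMIPG_hom RMIPG_id RMIPG_comp _ _ _) => *;
  exact: RMIPG_hom_eq.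
Defined.

Definition finitely_many_vertices (E : RMIPG) : Prop :=
  finite_set [set: vert E].

Definition bijective_on_vertices (E F : RMIPG) (f : arrow E F) : Prop :=
  bijective (vmap (f : RMIPG_hom E F)).

Lemma bijective_on_vertices_id (E : RMIPG) :
  finitely_many_vertices E -> bijective_on_vertices (id_arrow E).
Proof. by move=> _; exists id. Qed.

Lemma bijective_on_vertices_comp (E F G : RMIPG)
    (g : arrow F G) (f : arrow E F) :
  bijective_on_vertices g -> bijective_on_vertices f ->
  bijective_on_vertices (compose g f).
Proof.
move=> bg bf; apply: (eq_bij (bij_comp bg bf)) => v.
by rewrite /= vmap_comp.
Qed.

Definition RMBPG : category :=
  subcategory bijective_on_vertices_id bijective_on_vertices_comp.

Record kalgebra (k : fieldType) := KAlgebra {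
  kmod :> lmodType k;
  kmul : kmod -> kmod -> kmod;
  kmulA : associative kmul;
  kmul_linearl : forall b, linear (kmul^~ b);
  kmul_linearr : forall a, linear (kmul a)
}.
Arguments kmul {k _} _ _.

Record kalg_hom (k : fieldType) (A B : kalgebra k) := KAlgHom {
  khom_fun :> A -> B;
  khom_linear : linear khom_fun;
  khom_mul : {morph khom_fun : a b / kmul a b}
}.

Section KA.
Variable k : fieldType.

Lemma kalg_hom_eq (A B : kalgebra k) (f g : kalg_hom A B) :
  f = g :> (A -> B) -> f = g.
Proof.
case: f g => f a b [g a' b'] /= fg; subst g.
by rewrite (Prop_irrelevance a a') (Prop_irrelevance b b').
Qed.

Definition kalg_id (A : kalgebra k) : kalg_hom A A.
Proof. by refine (@KAlgHom k A A id _ _). Defined.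

Definition kalg_comp (A B C : kalgebra k) (g : kalg_hom B C)
  (f : kalg_hom A B) : kalg_hom A C.
Proof.
refine (@KAlgHom k A C (g \o f) _ _).
- by move=> c a b; rewrite /= !khom_linear.
- by move=> a b; rewrite /= !khom_mul.
Defined.

Definition KA : category.
Proof.
by refine (@Category (kalgebra k) (@kalg_hom k) kalg_id kalg_comp _ _ _) => *;
  exact: kalg_hom_eq.
Defined.

Definition is_unit_of (A : kalgebra k) (u : A) : Prop :=
  left_id u kmul /\ right_id u kmul.

Definition unital (A : KA) : Prop := exists u, @is_unit_of A u.

(* The unit is unique, so this says that [f] maps the unit of [A] to the unit
   of [B]. *)
Definition unital_hom (A B : KA) (f : arrow A B) : Prop :=
  forall u, @is_unit_of A u -> @is_unit_of B ((f : kalg_hom A B) u).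

Lemma unital_hom_id (A : KA) : unital A -> unital_hom (id_arrow A).
Proof. by move=> _ u. Qed.

Lemma unital_hom_comp (A B C : KA) (g : arrow B C) (f : arrow A B) :
  unital_hom g -> unital_hom f -> unital_hom (compose g f).
Proof. by move=> ug uf u /uf /ug. Qed.

Definition UKA : category := subcategory unital_hom_id unital_hom_comp.

End KA.

Record ideal (k : fieldType) (A : kalgebra k) := Ideal {
  ideal_set :> A -> Prop;
  ideal0 : ideal_set 0;
  ideal_linear : forall (c : k) a b,
    ideal_set a -> ideal_set b -> ideal_set (c *: a + b);
  ideal_mull : forall a b, ideal_set b -> ideal_set (kmul a b);
  ideal_mulr : forall a b, ideal_set a -> ideal_set (kmul a b)
}.

Section GeneratedIdeal.
Variables (k : fieldType) (A : kalgebra k) (S : set A).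

Definition generated_ideal : ideal A.
Proof.
refine (@Ideal k A [set a | forall I : ideal A, S `<=` I -> I a] _ _ _ _).
- by move=> I _; exact: ideal0.
- by move=> c a b Ha Hb I SI; apply: ideal_linear; [exact: Ha|exact: Hb].
- by move=> a b Hb I SI; apply: ideal_mull; exact: Hb.
- by move=> a b Ha I SI; apply: ideal_mulr; exact: Ha.
Defined.

End GeneratedIdeal.

Section Quotient.
Variables (k : fieldType) (A : kalgebra k) (I : ideal A).
Local Open Scope quotient_scope.

Definition ideal_pred : pred A := fun a => `[< I a >].

Lemma ideal_zmod_closed : zmod_closed ideal_pred.
Proof.
split=> [|a b /asboolP Ia /asboolP Ib]; apply/asboolP; first exact: ideal0.
by rewrite addrC -scaleN1r; exact: ideal_linear.
Qed.

HB.instance Definition _ :=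
  GRing.isZmodClosed.Build A ideal_pred ideal_zmod_closed.

Local Notation Q :=
  (@ring_quotient.Quotient.quot A (GRing.ZmodClosed.clone A ideal_pred _)).
Definition quot_mod : Type := Q.

HB.instance Definition _ := GRing.Zmodule.on quot_mod.

Definition quot_pi (a : A) : quot_mod := \pi_Q a.
Definition quot_repr (x : quot_mod) : A := repr (x : Q).
Definition quot_scale (c : k) (x : quot_mod) := quot_pi (c *: quot_repr x).
Definition quot_mul (x y : quot_mod) :=
  quot_pi (kmul (quot_repr x) (quot_repr y)).

Lemma quot_reprK x : quot_pi (quot_repr x) = x.
Proof. exact: (@reprK _ Q). Qed.

Lemma quot_piP a b : quot_pi a = quot_pi b <-> I (a - b).
Proof.
split=> [/eqP|Iab].
  by rewrite /quot_pi -ring_quotient.Quotient.idealrBE => /asboolP.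
by apply/eqP; rewrite /quot_pi -ring_quotient.Quotient.idealrBE; apply/asboolP.
Qed.

Lemma quot_repr_pi a : I (quot_repr (quot_pi a) - a).
Proof. by apply/quot_piP; rewrite quot_reprK. Qed.

Lemma quot_piD : {morph quot_pi : a b / a + b}.
Proof. by move=> a b; exact: (raddfD (\pi_Q)). Qed.

Lemma quot_piZ c a : quot_pi (c *: a) = quot_scale c (quot_pi a).
Proof.
apply/esym/quot_piP; rewrite -scalerBr -[_ *: _]addr0.
by apply: ideal_linear; [exact: quot_repr_pi|exact: ideal0].
Qed.

Lemma quot_piM a b : quot_pi (kmul a b) = quot_mul (quot_pi a) (quot_pi b).
Proof.
apply/esym/quot_piP; set a' := quot_repr _; set b' := quot_repr _.
have -> : kmul a' b' - kmul a b = kmul (a' - a) b' + kmul a (b' - b).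
  rewrite [a' - a]addrC -[- a]scaleN1r kmul_linearl scaleN1r.
  rewrite [b' - b]addrC -[- b]scaleN1r kmul_linearr scaleN1r.
  by rewrite [- kmul a b' + _]addrC [- kmul a b + _]addrC addrA addrNK.
rewrite -[kmul (a' - a) b']scale1r; apply: ideal_linear.
  exact/ideal_mulr/quot_repr_pi.
exact/ideal_mull/quot_repr_pi.
Qed.

Lemma quot_scaleA c d x : quot_scale c (quot_scale d x) = quot_scale (c * d) x.
Proof. by rewrite -[x]quot_reprK -!quot_piZ scalerA. Qed.

Lemma quot_scale1 : left_id 1 quot_scale.
Proof. by move=> x; rewrite -[x]quot_reprK -quot_piZ scale1r. Qed.

Lemma quot_scaleDr : right_distributive quot_scale +%R.
Proof.
move=> c x y; rewrite -[x]quot_reprK -[y]quot_reprK.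
by rewrite -quot_piD -!quot_piZ scalerDr quot_piD.
Qed.

Lemma quot_scaleDl x : {morph quot_scale^~ x : c d / c + d}.
Proof.
by move=> c d; rewrite -[x]quot_reprK -!quot_piZ scalerDl quot_piD.
Qed.

HB.instance Definition _ := GRing.Zmodule_isLmodule.Build k quot_mod
  quot_scaleA quot_scale1 quot_scaleDr quot_scaleDl.

Definition quotient : kalgebra k.
Proof.
refine (@KAlgebra k quot_mod quot_mul _ _ _).
- move=> x y z; rewrite -[x]quot_reprK -[y]quot_reprK -[z]quot_reprK.
  by rewrite -!quot_piM kmulA.
- move=> z c x y; rewrite -[x]quot_reprK -[y]quot_reprK -[z]quot_reprK.
  by rewrite -[_ *: _]quot_piZ -quot_piD -!quot_piM kmul_linearl
    quot_piD quot_piZ.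
- move=> z c x y; rewrite -[x]quot_reprK -[y]quot_reprK -[z]quot_reprK.
  by rewrite -[_ *: _]quot_piZ -quot_piD -!quot_piM kmul_linearr
    quot_piD quot_piZ.
Defined.

Definition class_of (a : A) : quotient := quot_pi a.

End Quotient.

Section LinearExtension.
Variables (k : fieldType) (K : choiceType) (V : lmodType k) (h : K -> V).

Definition linext (a : {malg k[K]}) : V := \sum_(x <- msupp a) a@_x *: h x.

Lemma linextEw (d : {fset K}) (a : {malg k[K]}) : (msupp a `<=` d)%fset ->
  linext a = \sum_(x <- d) a@_x *: h x.
Proof.
move=> ad; rewrite /linext; apply: big_fset_incl => // x _ /mcoeff_outdom ->.
by rewrite scale0r.
Qed.

Lemma linext_linear : linear linext.
Proof.
move=> c a b; pose d := (msupp a `|` msupp b `|` msupp (c *: a + b))%fset.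
rewrite !(@linextEw d) ?scaler_sumr -?big_split/=.
- by apply: eq_bigr => x _; rewrite mcoeffD mcoeffZ scalerDl scalerA.
- by apply/fsubsetP => x; rewrite !inE => ->; rewrite ?orbT.
- by apply/fsubsetP => x; rewrite !inE => ->; rewrite ?orbT.
- by apply/fsubsetP => x; rewrite !inE => ->; rewrite ?orbT.
Qed.

Lemma linextU x : linext << x >> = h x.
Proof.
rewrite (@linextEw [fset x]%fset) ?msuppU_le// big_seq_fset1.
by rewrite mcoeffUU scale1r.
Qed.

End LinearExtension.

Lemma linear_malg_eq (k : fieldType) (K : choiceType) (V : lmodType k)
    (u v : {malg k[K]} -> V) : linear u -> linear v ->
  (forall x, u << x >> = v << x >>) -> u =1 v.
Proof.
move=> lu lv uv a.
have sumE (w : {malg k[K]} -> V) : linear w ->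
    w a = \sum_(x <- msupp a) a@_x *: w << x >>.
  move=> lw.
  have w0 : w 0 = 0.
    by have := lw (-1) 0 0; rewrite !scaleN1r oppr0 addr0 addNr.
  have wD x y : w (x + y) = w x + w y by rewrite -[x]scale1r lw !scale1r.
  have wZ c x : w (c *: x) = c *: w x by rewrite -[c *: x]addr0 lw w0 addr0.
  rewrite {1}[a]monalgE (big_morph w wD w0); apply: eq_bigr => x _.
  rewrite -wZ; congr w; apply/malgP => y.
  by rewrite mcoeffZ !mcoeffU mulr_natr.
by rewrite (sumE u lu) (sumE v lv); apply: eq_bigr => x _; rewrite uv.
Qed.

Section PathAlgebra.
Variables (k : fieldType) (E : graph).
Local Notation kFP := {malg k[FP E]}.

Definition path_mul (p q : FP E) : kFP :=
  if `[< ftgt p = fsrc q >] then << p ⋅ q >> else 0.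

Definition path_alg_mul (a b : kFP) : kFP :=
  linext (fun p => linext (path_mul p) b) a.

Lemma path_alg_mul_linearl b : linear (path_alg_mul^~ b).
Proof. exact: linext_linear. Qed.

Lemma path_alg_mul_linearr a : linear (path_alg_mul a).
Proof.
move=> c b1 b2; rewrite /path_alg_mul /linext scaler_sumr -big_split/=.
by apply: eq_bigr => p _; rewrite -/(linext _ _) linext_linear scalerDr
  !scalerA mulrC.
Qed.

Lemma path_alg_mulU p q : path_alg_mul << p >> << q >> = path_mul p q.
Proof. by rewrite /path_alg_mul !linextU. Qed.

Lemma path_alg_mul0 a : path_alg_mul a 0 = 0.
Proof.
have := path_alg_mul_linearr a (-1) 0 0.
by rewrite !scaleN1r oppr0 addr0 addNr.
Qed.

Lemma path_alg_0mul a : path_alg_mul 0 a = 0.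
Proof.
have := path_alg_mul_linearl a (-1) 0 0.
by rewrite !scaleN1r oppr0 addr0 addNr.
Qed.

Lemma path_mulA p q r :
  path_alg_mul << p >> (path_mul q r) = path_alg_mul (path_mul p q) << r >>.
Proof.
rewrite /path_mul; case: asboolP => qr; case: asboolP => pq;
  rewrite ?path_alg_mul0 ?path_alg_0mul// !path_alg_mulU
  /path_mul ?fsrc_cat.
- by rewrite ftgt_cat// !asboolT// fcatA.
- by rewrite asboolF.
- by rewrite ftgt_cat// asboolF.
Qed.

Lemma path_alg_mulA : associative path_alg_mul.
Proof.
have ll := path_alg_mul_linearl; have lr := path_alg_mul_linearr.
move=> a b c.
apply: (@linear_malg_eq _ _ _ (fun a => path_alg_mul a (path_alg_mul b c))
  (fun a => path_alg_mul (path_alg_mul a b) c)) => [||p].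
- exact: ll.
- by move=> d x y; rewrite !ll.
apply: (@linear_malg_eq _ _ _
  (fun b => path_alg_mul << p >> (path_alg_mul b c))
  (fun b => path_alg_mul (path_alg_mul << p >> b) c)) => [||q].
- by move=> d x y; rewrite ll lr.
- by move=> d x y; rewrite lr ll.
apply: (@linear_malg_eq _ _ _
  (fun c => path_alg_mul << p >> (path_alg_mul << q >> c))
  (fun c => path_alg_mul (path_alg_mul << p >> << q >>) c)) => [||r].
- by move=> d x y; rewrite !lr.
- exact: lr.
by rewrite !path_alg_mulU path_mulA.
Qed.

Definition path_algebra : kalgebra k :=
  KAlgebra path_alg_mulA path_alg_mul_linearl path_alg_mul_linearr.

Definition chi (p : FP E) : path_algebra := (<< p >> : kFP).

End PathAlgebra.
Arguments chi k {E} p.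

(* The extended graph: [inl e] is the edge e and [inr e] the ghost edge e^*. *)
Definition ext (E : graph) : graph := @Graph (vert E) (edge E + edge E)%type
  (fun x => match x with inl e => src e | inr e => tgt e end)
  (fun x => match x with inl e => tgt e | inr e => src e end).

Definition vertE (E : graph) (v : vert E) : FP (ext E) := @vpath (ext E) v.
Definition realE (E : graph) (e : edge E) : FP (ext E) :=
  @epath (ext E) (inl e).
Definition ghostE (E : graph) (e : edge E) : FP (ext E) :=
  @epath (ext E) (inr e).

Section Leavitt.
Variables (k : fieldType) (E : graph).
Local Notation kE := (path_algebra k (ext E)).

Definition CK1 : set kE :=
  [set kmul (chi k (ghostE e.1)) (chi k (realE e.2))
       - (if e.1 == e.2 then chi k (vertE (tgt e.1)) else 0)
  | e in [set: edge E * edge E]].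

Definition CK2 : set kE :=
  [set \sum_(e \in out v) kmul (chi k (realE e)) (chi k (ghostE e))
       - chi k (vertE v)
  | v in [set v : vert E | reg v]].

Definition leavitt : kalgebra k := quotient (generated_ideal (CK1 `|` CK2)).

Definition leavitt_class (a : kE) : leavitt := class_of _ a.

End Leavitt.
Arguments leavitt_class {k E} a.

Section Lift.
Variables (E F : graph) (h0 : vert E -> vert F) (h : edge E -> FP F).
Hypothesis h_src : forall e, fsrc (h e) = h0 (src e).
Hypothesis h_tgt : forall e, ftgt (h e) = h0 (tgt e).

(* The concatenation of the paths [h e] along [s], starting at [h0 v]. *)
Fixpoint lift_edges (v : vert E) (s : seq (edge E)) : FP F :=
  if s is e :: s' then h e ⋅ lift_edges (tgt e) s' else vpath (h0 v).

Definition lift_fun (p : FP E) : FP F := lift_edges (fsrc p) (fedges p).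

Lemma fsrc_lift v s : is_path v s -> fsrc (lift_edges v s) = h0 v.
Proof. by case: s => //= e s [<- _]; rewrite fsrc_cat h_src. Qed.

Lemma ftgt_lift v s : is_path v s ->
  ftgt (lift_edges v s) = h0 (last v (map tgt s)).
Proof.
elim: s v => //= e s IH v [_ es].
by rewrite ftgt_cat ?IH// h_tgt fsrc_lift.
Qed.

Lemma lift_cat v s t : is_path v s -> is_path (last v (map tgt s)) t ->
  lift_edges v (s ++ t) = lift_edges v s ⋅ lift_edges (last v (map tgt s)) t.
Proof.
elim: s v => /= [v _ vt|e s IH v [_ es] st].
  by rewrite -[X in vpath X](fsrc_lift vt) fvcat.
by rewrite IH// fcatA// ?h_tgt ?fsrc_lift ?ftgt_lift.
Qed.

Definition lift : path_hom E F.
Proof.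
refine (@PathHom E F lift_fun _ _ _ _).
- by move=> v; exists (h0 v).
- by move=> p; rewrite fsrc_lift//; exact: fpathP.
- by move=> p; rewrite ftgt_lift//; exact: fpathP.
- move=> p q pq; rewrite /lift_fun fsrc_cat fedges_cat// lift_cat//.
  + by rewrite -/(ftgt p) pq.
  + exact: fpathP.
  + by rewrite -/(ftgt p) pq; exact: fpathP.
Defined.

Lemma lift_vpath v : lift (vpath v) = vpath (h0 v).
Proof. by []. Qed.

Lemma lift_epath e : lift (epath e) = h e.
Proof. by rewrite /lift /lift_fun /= -h_tgt fcatv. Qed.

End Lift.

Section Ext.
Variable E : graph.

Lemma real_subproof (p : FP E) : @is_path (ext E) (fsrc p) (map inl (fedges p)).
Proof.
case: p => v s /= vs; elim: s v vs => //= e s IH v [ev es]; split=> //.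
exact: IH.
Qed.

Definition real_path (p : FP E) : FP (ext E) := FPath (real_subproof p).

Lemma ghost_subproof (p : FP E) :
  @is_path (ext E) (ftgt p) (map inr (rev (fedges p))).
Proof.
case: p => v s; rewrite /ftgt /= => vs.
elim/last_ind: s vs => //= s e IH; rewrite -cats1 => /is_path_cat[vs [es _]].
rewrite cats1 rev_rcons map_rcons last_rcons /=; split=> //.
by rewrite es; exact: IH.
Qed.

Definition ghost_path (p : FP E) : FP (ext E) := FPath (ghost_subproof p).

Lemma ftgt_real_path p : ftgt (real_path p) = ftgt p.
Proof. by rewrite /ftgt /= -map_comp. Qed.

Lemma ftgt_ghost_path p : ftgt (ghost_path p) = fsrc p.
Proof.
case: p => v [//|e s] vs; rewrite /ftgt /=.
by rewrite rev_cons map_rcons map_rcons last_rcons /=; case: vs.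
Qed.

End Ext.

Section ExtHom.
Variables (E F : graph) (f : path_hom E F).

Definition ext_edge (x : edge (ext E)) : FP (ext F) :=
  match x with
  | inl e => real_path (f (epath e))
  | inr e => ghost_path (f (epath e))
  end.

Lemma fsrc_ext_edge x : fsrc (ext_edge x) = vmap f (src x).
Proof. by case: x => e; rewrite /= ?ph_fsrc ?ph_ftgt. Qed.

Lemma ftgt_ext_edge x : ftgt (ext_edge x) = vmap f (tgt x).
Proof.
by case: x => e; rewrite ?ftgt_real_path ?ftgt_ghost_path ?ph_fsrc ?ph_ftgt.
Qed.

Definition ext_hom : path_hom (ext E) (ext F) :=
  @lift (ext E) (ext F) (vmap f) ext_edge fsrc_ext_edge ftgt_ext_edge.

End ExtHom.

(* Main.v *)
From HB Require Import structures.
Require Import Defs.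
From mathcomp Require Import all_boot all_algebra.
From mathcomp Require Import finmap.
From mathcomp Require Import boolp classical_sets cardinality fsbigop.

(** A path homomorphism [f] from [E] to [F] extends to the extended graphs, and
    linearly to their path algebras, where it is multiplicative on products of
    paths that compose. Products of paths that do not compose are zero, and
    injectivity on vertices keeps them so. To pass to the quotients, the images
    of the two families of Cuntz-Krieger relations must hold in [L_k(F)].

    The relation [e^* e' = delta_{e,e'} t(e)] holds for images because
    [p^* p = t(p)] for every path [p], while [p^* q = 0] as soon as neither path
    is a prefix of the other ([ghost_real], [ghost_real_incomparable]);
    monotonicity says exactly that distinct edges have incomparable images.

    The relation [sum_e e e^* = v] at a regular vertex [v] is the heart of the
    matter. If [f] sends the edges leaving [v] to vertices, then [v] emits a
    single edge and the relation is trivial. Otherwise regularity and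
    monotonicity say that the images of the edges leaving [v] form a finite
    complete prefix code: a finite set of paths from [f(v)], pairwise
    incomparable, such that wherever one of them goes on along an edge [a],
    others go on along each of the edges leaving the source of [a]. These paths
    are the leaves of a finite tree whose inner nodes end at regular vertices.
    Collapsing the tree from the leaves with the second relation in [L_k(F)]
    shows that the sum of [p p^* ] over the leaves is [f(v)]
    ([prefix_code_sum]).

    Functoriality and uniqueness follow since the classes of paths span the
    Leavitt path algebra and the extension to extended graphs is compatible with
    composition. When there are finitely many vertices, their sum is the unit.
    A morphism that is surjective on vertices preserves the unit [u]: every
    vertex [w] of [F] is the image of some [v], so that the image of [u] fixes
    [w], hence every path that starts or ends at [w]. *)

Set Implicit Arguments.
Unset Strict Implicit.
Unset Printing Implicit Defensive.

Import GRing.Theory.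
Local Open Scope classical_set_scope.
Local Open Scope ring_scope.

(** * Linear maps and algebra homomorphisms *)

Section LinearFacts.
Variables (k : fieldType) (U V : lmodType k) (u : U -> V).
Hypothesis lu : linear u.

Lemma lin0 : u 0 = 0.
Proof. by have := lu (-1) 0 0; rewrite !scaleN1r oppr0 addr0 addNr. Qed.

Lemma linD x y : u (x + y) = u x + u y.
Proof. by rewrite -[x]scale1r lu !scale1r. Qed.

Lemma linB x y : u (x - y) = u x - u y.
Proof. by rewrite addrC -scaleN1r lu scaleN1r addrC. Qed.

Lemma lin_sum I (r : seq I) (P : pred I) (G : I -> U) :
  u (\sum_(i <- r | P i) G i) = \sum_(i <- r | P i) u (G i).
Proof. exact: (big_morph u linD lin0). Qed.

End LinearFacts.

Section Algebra.
Variable k : fieldType.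

Lemma kmulr0 (A : kalgebra k) (a : A) : kmul a 0 = 0.
Proof. exact: (lin0 (kmul_linearr a)). Qed.

Lemma kmul0r (A : kalgebra k) (a : A) : kmul 0 a = 0.
Proof. exact: (lin0 (kmul_linearl a)). Qed.

Lemma path_algebra_mulE (E : graph) (p q : FP E) :
  kmul (chi k p) (chi k q)
    = if `[< ftgt p = fsrc q >] then chi k (p ⋅ q) else 0.
Proof. exact: path_alg_mulU. Qed.

Section PathAlgebraHom.
Variables (E : graph) (B : kalgebra k) (h : FP E -> B).
Hypothesis h_mul : forall p q,
  kmul (h p) (h q) = if `[< ftgt p = fsrc q >] then h (p ⋅ q) else 0.

Definition path_algebra_ext : path_algebra k E -> B := linext h.

Lemma path_algebra_ext_linear : linear path_algebra_ext.
Proof. exact: linext_linear. Qed.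

Lemma path_algebra_extU p : path_algebra_ext (chi k p) = h p.
Proof. exact: linextU. Qed.

Lemma path_algebra_ext_mul : {morph path_algebra_ext : a b / kmul a b}.
Proof.
have le := path_algebra_ext_linear.
move=> a b.
apply: (@linear_malg_eq k (FP E) B
  (fun a => path_algebra_ext (@kmul k (path_algebra k E) a b))
  (fun a => kmul (path_algebra_ext a) (path_algebra_ext b))) => [||p].
- by move=> c x y; rewrite (kmul_linearl (b : path_algebra k E)) le.
- by move=> c x y; rewrite le kmul_linearl.
apply: (@linear_malg_eq k (FP E) B
  (fun b => path_algebra_ext (@kmul k (path_algebra k E) (chi k p) b))
  (fun b => kmul (path_algebra_ext (chi k p)) (path_algebra_ext b))) => [||q].
- by move=> c x y; rewrite (kmul_linearr (chi k p)) le.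
- by move=> c x y; rewrite le kmul_linearr.
rewrite -/(chi k q) path_algebra_mulE !path_algebra_extU h_mul.
by case: ifP => _; rewrite ?path_algebra_extU// (lin0 le).
Qed.

Definition path_algebra_hom : kalg_hom (path_algebra k E) B :=
  KAlgHom path_algebra_ext_linear path_algebra_ext_mul.

End PathAlgebraHom.

Section QuotientHom.
Variables (A B : kalgebra k) (phi : kalg_hom A B).

Definition kernel : ideal A.
Proof.
refine (@Ideal k A (fun a => phi a = 0) _ _ _ _).
- exact: (lin0 (khom_linear phi)).
- by move=> c a b a0 b0; rewrite khom_linear a0 b0 scaler0 addr0.
- by move=> a b b0; rewrite khom_mul b0 kmulr0.
- by move=> a b a0; rewrite khom_mul a0 kmul0r.
Defined.

Variable I : ideal A.
Hypothesis I_ker : forall a, I a -> phi a = 0.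

Definition quotient_fun (x : quotient I) : B := phi (quot_repr x).

Lemma quotient_fun_class a : quotient_fun (class_of I a) = phi a.
Proof.
apply/eqP; rewrite -subr_eq0 -(linB (khom_linear phi)); apply/eqP.
exact/I_ker/quot_repr_pi.
Qed.

Lemma class_of_linear : linear (class_of I).
Proof. by move=> c a b; rewrite /class_of quot_piD quot_piZ. Qed.

Lemma class_of_mul : {morph class_of I : a b / kmul a b}.
Proof. exact: quot_piM. Qed.

Lemma class_of_surj (x : quotient I) : exists a, x = class_of I a.
Proof. by exists (quot_repr x); rewrite /class_of quot_reprK. Qed.

Lemma quotient_fun_linear : linear quotient_fun.
Proof.
move=> c x y; have [a ->] := class_of_surj x; have [b ->] := class_of_surj y.
by rewrite -class_of_linear !quotient_fun_class khom_linear.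
Qed.

Lemma quotient_fun_mul : {morph quotient_fun : x y / kmul x y}.
Proof.
move=> x y; have [a ->] := class_of_surj x; have [b ->] := class_of_surj y.
by rewrite -class_of_mul !quotient_fun_class khom_mul.
Qed.

Definition quotient_hom : kalg_hom (quotient I) B :=
  KAlgHom quotient_fun_linear quotient_fun_mul.

End QuotientHom.

(** * Relations and universal property of Leavitt path algebras *)

Section LeavittRelations.
Variable E : graph.
Implicit Types p q : FP (ext E).

Definition path_class p : leavitt k E := leavitt_class (chi k p).

Lemma leavitt_class_linear : linear (@leavitt_class k E).
Proof. exact: class_of_linear. Qed.

Lemma leavitt_class_mul : {morph @leavitt_class k E : a b / kmul a b}.
Proof. exact: class_of_mul. Qed.

Lemma path_class_mulE p q : kmul (path_class p) (path_class q)
  = if `[< ftgt p = fsrc q >] then path_class (p ⋅ q) else 0.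
Proof.
rewrite -leavitt_class_mul path_algebra_mulE; case: ifP => // _.
exact: (lin0 leavitt_class_linear).
Qed.

Lemma path_class_mul p q : ftgt p = fsrc q ->
  kmul (path_class p) (path_class q) = path_class (p ⋅ q).
Proof. by move=> pq; rewrite path_class_mulE asboolT. Qed.

Lemma leavitt_linear_eq (V : lmodType k) (u v : leavitt k E -> V) :
  linear u -> linear v ->
  (forall p, u (path_class p) = v (path_class p)) -> u =1 v.
Proof.
move=> lu lv uv x; have [a ->] := class_of_surj x.
apply: (@linear_malg_eq k (FP (ext E)) V (u \o @leavitt_class k E)
  (v \o @leavitt_class k E)) => [c y z|c y z|p] /=.
- by rewrite leavitt_class_linear lu.
- by rewrite leavitt_class_linear lv.
- exact: uv.
Qed.

Lemma leavitt_class_eq0 a : (@CK1 k E `|` @CK2 k E) a ->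
  leavitt_class a = 0.
Proof.
move=> Sa; rewrite -[RHS](lin0 leavitt_class_linear); apply/quot_piP.
by rewrite subr0 => I; apply.
Qed.

Lemma mem_out (v : vert E) (rv : reg v) (e : edge E) :
  e \in fset_set (out v) <-> src e = v.
Proof.
rewrite in_fset_set; last exact: rv.1.
by split=> [/set_mem|/mem_set].
Qed.

Lemma ghost_real_edge e e' :
  kmul (path_class (ghostE e)) (path_class (realE e'))
    = if e == e' then path_class (vertE (tgt e)) else 0.
Proof.
rewrite -leavitt_class_mul; apply/eqP; rewrite -subr_eq0; apply/eqP.
set R := if _ then _ else _.
have -> : R = leavitt_class (if e == e' then chi k (vertE (tgt e)) else 0).
  by rewrite /R; case: ifP => // _; rewrite (lin0 leavitt_class_linear).
rewrite -(linB leavitt_class_linear); apply: leavitt_class_eq0.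
by left; exists (e, e').
Qed.

Lemma sum_real_ghost_edge v : reg v ->
  \sum_(e <- fset_set (out v))
      kmul (path_class (realE e)) (path_class (ghostE e))
    = path_class (vertE v).
Proof.
move=> rv; apply/eqP; rewrite -subr_eq0; apply/eqP.
under eq_bigr do rewrite -leavitt_class_mul.
rewrite -(lin_sum leavitt_class_linear) -(linB leavitt_class_linear).
apply: leavitt_class_eq0; right; exists v => //.
by rewrite fsbig_finite//; exact: rv.1.
Qed.

(** The kernel of [phi] is an ideal, so it contains the ideal generated by the
    relations as soon as it contains the relations. *)
Lemma leavitt_rec (B : kalgebra k) (phi : kalg_hom (path_algebra k (ext E)) B) :
  (forall a, (@CK1 k E `|` @CK2 k E) a -> phi a = 0) ->
  exists psi : kalg_hom (leavitt k E) B,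
    forall a, psi (leavitt_class a) = phi a.
Proof.
move=> phi0.
have I_ker a : generated_ideal (@CK1 k E `|` @CK2 k E) a -> phi a = 0.
  by move=> /(_ (kernel phi)); apply.
by exists (quotient_hom I_ker) => a; exact: quotient_fun_class.
Qed.

End LeavittRelations.

(* From here on, only the relations above matter. Unfolding the quotient would
   make failing conversion tests between elements very slow. *)
Opaque leavitt.

(** * Real and ghost paths *)

(** Paths are records over edge lists; this recovers structural induction on the
    first edge. *)
Lemma path_cons_ind (E : graph) (K : FP E -> Prop) :
  (forall v, K (vpath v)) ->
  (forall e p, fsrc p = tgt e -> K p -> K (epath e ⋅ p)) ->
  forall p, K p.
Proof.
move=> K0 K1 p; move ps : (fedges p) => s; elim: s p ps => [|e s IH] p ps.
  by rewrite (flen0_vpath (_ : flen p = 0%N)) ?/flen ?ps.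
have [q [qe qs -> _]] := ph_cons (path_id E) ps.
exact/K1/IH.
Qed.


Section RealGhost.
Variable E : graph.
Implicit Types (p q : FP E) (e : edge E) (v : vert E).

Lemma real_path_cat p q : ftgt p = fsrc q ->
  real_path (p ⋅ q) = real_path p ⋅ real_path q.
Proof.
move=> pq; apply: fpath_eq; rewrite /= ?fsrc_cat//.
by rewrite !fedges_cat ?ftgt_real_path// map_cat.
Qed.

Lemma ghost_path_cat p q : ftgt p = fsrc q ->
  ghost_path (p ⋅ q) = ghost_path q ⋅ ghost_path p.
Proof.
move=> pq; apply: fpath_eq; rewrite /= ?fsrc_cat ?ftgt_cat//.
by rewrite !fedges_cat ?ftgt_ghost_path//= rev_cat map_cat.
Qed.

Lemma real_path_edge e : real_path (epath e) = realE e.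
Proof. exact: fpath_eq. Qed.

Lemma ghost_path_edge e : ghost_path (epath e) = ghostE e.
Proof. exact: fpath_eq. Qed.

Lemma real_path_vertex v : real_path (vpath v) = vertE v.
Proof. exact: fpath_eq. Qed.

Lemma ghost_path_vertex v : ghost_path (vpath v) = vertE v.
Proof. exact: fpath_eq. Qed.

Definition real p : leavitt k E := path_class (real_path p).
Definition ghost p : leavitt k E := path_class (ghost_path p).

Lemma real_cat p q : ftgt p = fsrc q -> real (p ⋅ q) = kmul (real p) (real q).
Proof.
by move=> pq; rewrite /real real_path_cat// path_class_mul// ftgt_real_path.
Qed.

Lemma ghost_cat p q : ftgt p = fsrc q ->
  ghost (p ⋅ q) = kmul (ghost q) (ghost p).
Proof.
by move=> pq; rewrite /ghost ghost_path_cat// path_class_mul// ftgt_ghost_path.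
Qed.

Lemma real_vertex v : real (vpath v) = path_class (vertE v).
Proof. by rewrite /real real_path_vertex. Qed.

Lemma ghost_vertex v : ghost (vpath v) = path_class (vertE v).
Proof. by rewrite /ghost ghost_path_vertex. Qed.

Lemma vertex_mul_real p : kmul (path_class (vertE (fsrc p))) (real p) = real p.
Proof. by rewrite -[in RHS](fvcat p) real_cat// real_vertex. Qed.

Lemma vertex_mul_ghost p :
  kmul (path_class (vertE (ftgt p))) (ghost p) = ghost p.
Proof. by rewrite -[in RHS](fcatv p) ghost_cat// ghost_vertex. Qed.

Lemma ghost_real_cons e e' p q : fsrc p = tgt e -> fsrc q = tgt e' ->
  kmul (ghost (epath e ⋅ p)) (real (epath e' ⋅ q))
    = if e == e' then kmul (ghost p) (real q) else 0.
Proof.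
move=> pe qe'; rewrite ghost_cat// real_cat//.
rewrite -kmulA [kmul (ghost (epath e)) _]kmulA.
rewrite /ghost ghost_path_edge /real real_path_edge ghost_real_edge.
case: eqP => [ee'|_]; last by rewrite kmul0r kmulr0.
by subst e'; rewrite -qe' vertex_mul_real.
Qed.

Lemma ghost_real p : kmul (ghost p) (real p) = path_class (vertE (ftgt p)).
Proof.
elim/path_cons_ind: p => [v|e p pe IH].
  by rewrite ghost_vertex (vertex_mul_real (vpath v)) real_vertex.
by rewrite ghost_real_cons// eqxx IH ftgt_cat.
Qed.

(** The two paths diverge: after cancelling their common beginning, one meets a
    product [e^* e'] of distinct edges, or two distinct vertices. *)
Lemma ghost_real_incomparable p q : ~ prec p q -> ~ prec q p ->
  kmul (ghost p) (real q) = 0.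
Proof.
elim/path_cons_ind: p q => [v|e p pe IH] q.
  move=> Npq _; rewrite /ghost /real path_class_mulE asboolF// => vq.
  by apply: Npq; exists q => //; rewrite [v](vq : v = fsrc q) fvcat.
elim/path_cons_ind: q => [w|e' q qe' _] Npq Nqp.
  rewrite /ghost /real path_class_mulE asboolF// ftgt_ghost_path => pw.
  by apply: Nqp; exists (epath e ⋅ p) => //; rewrite -[w]pw fvcat.
rewrite ghost_real_cons//; case: eqP => // ee'; subst e'.
apply: IH => -[r pr E_]; [apply: Npq|apply: Nqp]; exists r;
  by rewrite ?ftgt_cat// E_ fcatA.
Qed.

Lemma sum_real_ghost_cons p : reg (ftgt p) ->
  \sum_(e <- fset_set (out (ftgt p)))
      kmul (real (p ⋅ epath e)) (ghost (p ⋅ epath e))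
    = kmul (real p) (ghost p).
Proof.
move=> rp; rewrite -[in RHS]vertex_mul_ghost -sum_real_ghost_edge//.
rewrite (lin_sum (kmul_linearl _)) (lin_sum (kmul_linearr _)).
apply: eq_big_seq => e /(mem_out rp)/esym pe.
rewrite (@real_cat p (epath e) pe) (@ghost_cat p (epath e) pe).
by rewrite [real (epath e)]/real [ghost (epath e)]/ghost
  real_path_edge ghost_path_edge !kmulA.
Qed.

Lemma prec_eqVcons p q : prec p q ->
  (exists e s, fsrc p = fsrc q /\ fedges q = fedges p ++ e :: s) \/ q = p.
Proof.
move=> /precP[pq [[|e s] qs]]; last by left; exists e, s.
by right; apply: fpath_eq; rewrite ?qs ?cats0.
Qed.

Lemma prec_cat_edge p e q : ftgt p = src e ->
  prec (p ⋅ epath e) q <->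
    fsrc p = fsrc q /\ exists s, fedges q = fedges p ++ e :: s.
Proof.
move=> pe; rewrite precP fsrc_cat fedges_cat//=.
by split=> -[pq [s qs]]; split=> //; exists s; rewrite qs -catA.
Qed.

(** * Complete prefix codes *)

(** The family [P] indexed by [r] is a finite complete prefix code. The edges
    that follow a given proper beginning of a path of the code are exactly the
    edges leaving the vertex that it reaches. *)
Section PrefixCode.
Variables (I : choiceType) (r : seq I) (P : I -> FP E).
Hypothesis r_uniq : uniq r.
Hypothesis code : {in r &, forall i j, prec (P i) (P j) -> i = j}.
Hypothesis code_src : {in r &, forall i j, fsrc (P i) = fsrc (P j)}.
Hypothesis branch : forall i s1 e s2 e', i \in r ->
  fedges (P i) = s1 ++ e :: s2 -> src e' = src e ->
  exists2 j, j \in r & exists s3, fedges (P j) = s1 ++ e' :: s3.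

(** Finiteness comes from the code: by branching, each edge leaving the source
    of [e] is the edge at position [size s1] of some path of the code. *)
Lemma prefix_code_reg i s1 e s2 : i \in r ->
  fedges (P i) = s1 ++ e :: s2 -> reg (src e).
Proof.
move=> ir es; split; last by exists e.
apply: (@sub_finite_set _ _
  ((fun j => nth e (fedges (P j)) (size s1)) @` [set` r])).
  move=> e' e'e; have [j jr [s3 js]] := branch ir es e'e.
  by exists j => //; rewrite js nth_cat ltnn subnn.
exact/finite_image/finite_seq.
Qed.

Lemma prefix_code_sum_leaf i : i \in r ->
  \sum_(j <- r | `[< prec (P i) (P j) >]) kmul (real (P j)) (ghost (P j))
    = kmul (real (P i)) (ghost (P i)).
Proof.
move=> ir; rewrite -big_filter (bigD1_seq i) ?filter_uniq//=; last first.
  by rewrite mem_filter ir andbT; apply/asboolP; exact: prec_refl.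
rewrite big1_seq ?addr0// => j /andP[/eqP ji].
rewrite mem_filter => /andP[/asboolP ij jr]; case: ji.
by rewrite (code ir jr ij).
Qed.

(** The paths of the code that extend [q] are either [q] alone or they branch
    along every edge leaving the end of [q], so that the claim for [q] follows
    from those for its one-edge extensions by the second Cuntz-Krieger relation.
    The induction is on how much longer than [q] a path of the code can be. *)
Lemma prefix_code_sum q i : i \in r -> prec q (P i) ->
  \sum_(j <- r | `[< prec q (P j) >]) kmul (real (P j)) (ghost (P j))
    = kmul (real q) (ghost q).
Proof.
have [n] : exists n, {in r, forall i, (flen (P i) <= n + flen q)%N}.
  exists (\max_(i <- r) flen (P i))%N => j jr.
  by rewrite (leq_trans _ (leq_addr _ _))//; exact: leq_bigmax_seq.
elim: n q i => [|n IH] q i len_le ir qi;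
  have [[j0 j0r <-]|Nq] := pselect (exists2 j, j \in r & P j = q);
  try exact: prefix_code_sum_leaf;
  have [[e0 [s0 [qsrc qs]]]|qi'] := prec_eqVcons qi;
  try by case: Nq; exists i.
  have := len_le _ ir.
  by rewrite /flen qs size_cat add0n -[leqRHS]addn0 leq_add2l.
have qe0 : ftgt q = src e0.
  by have := Defs.fpathP (P i); rewrite qs -qsrc => /is_path_cat[_ [-> _]].
have rq : reg (ftgt q) by rewrite qe0; exact: prefix_code_reg ir qs.
rewrite -(sum_real_ghost_cons rq).
(* As [q] is not in the code, its extensions are sorted by their next edge. *)
transitivity (\sum_(e <- fset_set (out (ftgt q)))
  \sum_(j <- r | `[< prec (q ⋅ epath e) (P j) >])
    kmul (real (P j)) (ghost (P j))); last first.
  apply: eq_big_seq => e /(mem_out rq)/esym qe.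
  have [|j jr [s3 js]] := branch (e' := e) ir qs; first by rewrite -qe0.
  apply: (IH _ j) => //.
    move=> l lr; rewrite (leq_trans (len_le _ lr))//.
    by rewrite /flen fedges_cat// size_cat addn1 addnS.
  apply/prec_cat_edge => //; split; last by exists s3.
  by rewrite qsrc; exact: code_src.
under [RHS]eq_bigr do rewrite big_mkcond.
rewrite exchange_big/= [LHS]big_mkcond/=.
(* Each path of the code that extends [q] is counted for exactly one edge, the
   one that follows [q] in it. *)
apply: eq_big_seq => j jr; case: asboolP => [qj|Nqj]; last first.
  rewrite big1_seq// => e /andP[_] /(mem_out rq)/esym qe.
  case: asboolP => // /(prec_cat_edge _ qe)[qsrc' [s qs']].
  by case: Nqj; apply/precP; split=> //; exists (e :: s).
have [[e [s [qsrc' qs']]]|qj'] := prec_eqVcons qj; last by case: Nq; exists j.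
have qe : ftgt q = src e.
  by have := Defs.fpathP (P j); rewrite qs' -qsrc' => /is_path_cat[_ [-> _]].
rewrite (bigD1_seq e) ?fset_uniq//=; last exact/(mem_out rq)/esym.
rewrite asboolT; last by apply/prec_cat_edge => //; split=> //; exists s.
rewrite big1_seq ?addr0// => e' /andP[/eqP e'e] /(mem_out rq)/esym qe'.
case: asboolP => // /(prec_cat_edge _ qe')[_ [s']].
by rewrite qs' => /eqP; rewrite eqseq_cat// => /andP[_ /eqP[/esym]].
Qed.

End PrefixCode.
End RealGhost.

(** * Functoriality of the extension to extended graphs *)

Section ExtHomTheory.

Lemma path_hom_ext (E F : graph) (f g : path_hom E F) :
  vmap f =1 vmap g -> (forall e, f (epath e) = g (epath e)) -> f =1 g.
Proof.
move=> fg0 fg1; elim/path_cons_ind => [v|e p pe IH].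
  by rewrite !ph_vpath fg0.
by rewrite !ph_cat// fg1 IH.
Qed.

Lemma ext_hom_id (E : graph) : ext_hom (path_id E) =1 id.
Proof.
apply: (@path_hom_ext _ _ _ (path_id (ext E))) => // x.
by rewrite lift_epath; case: x => e; exact: fpath_eq.
Qed.

Lemma ext_hom_edge (E F : graph) (f : path_hom E F) (x : edge (ext E)) :
  ext_hom f (epath x) = ext_edge f x.
Proof. exact: lift_epath. Qed.

Lemma ext_hom_vertex (E F : graph) (f : path_hom E F) v :
  ext_hom f (vertE v) = vertE (vmap f v).
Proof. by []. Qed.

Lemma ext_hom_real (E F : graph) (f : path_hom E F) p :
  ext_hom f (real_path p) = real_path (f p).
Proof.
elim/path_cons_ind: p => [v|e p pe IH].
  by rewrite ph_vpath !real_path_vertex.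
rewrite real_path_cat// ph_cat ?ftgt_real_path// IH real_path_edge ext_hom_edge.
by rewrite ph_cat// real_path_cat// ph_ftgt ph_fsrc pe.
Qed.

Lemma ext_hom_ghost (E F : graph) (f : path_hom E F) p :
  ext_hom f (ghost_path p) = ghost_path (f p).
Proof.
elim/path_cons_ind: p => [v|e p pe IH].
  by rewrite ph_vpath !ghost_path_vertex.
rewrite ghost_path_cat// ph_cat ?ftgt_ghost_path// IH ghost_path_edge.
by rewrite ext_hom_edge ph_cat// ghost_path_cat// ph_ftgt ph_fsrc pe.
Qed.

Lemma ext_hom_comp (E F G : graph) (g : path_hom F G) (f : path_hom E F) :
  ext_hom (path_comp g f) =1 ext_hom g \o ext_hom f.
Proof.
apply: (@path_hom_ext _ _ _ (path_comp (ext_hom g) (ext_hom f))).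
  by move=> v; rewrite vmap_comp; exact: (vmap_comp g f v).
move=> x; rewrite -[RHS]/(ext_hom g (ext_hom f (epath x))) !ext_hom_edge.
by case: x => e; rewrite [in RHS]/ext_edge ?ext_hom_real ?ext_hom_ghost.
Qed.

End ExtHomTheory.

(** * The homomorphism induced by a morphism *)

Section LeavittHom.
Variables (E F : graph) (f : RMIPG_hom E F).

(** Injectivity on vertices is what keeps the product of two paths that do not
    compose equal to zero. *)
Lemma ext_hom_class_mul (p q : FP (ext E)) :
  kmul (path_class (ext_hom f p)) (path_class (ext_hom f q))
    = if `[< ftgt p = fsrc q >] then path_class (ext_hom f (p ⋅ q)) else 0.
Proof.
rewrite path_class_mulE; case: (asboolP (ftgt p = fsrc q)) => pq.
  by rewrite asboolT ?ph_cat// ph_ftgt ph_fsrc pq.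
by rewrite asboolF// ph_ftgt ph_fsrc => /(@rm_inj _ _ f).
Qed.

Lemma image_ghost_real e e' :
  kmul (ghost (f (epath e))) (real (f (epath e')))
    = if e == e' then path_class (vertE (vmap f (tgt e))) else 0.
Proof.
case: eqP => [<-|ee']; first by rewrite ghost_real ph_ftgt.
apply: ghost_real_incomparable => /(@rm_mono _ _ f) //.
by move/esym.
Qed.

(** Either the images of the edges leaving [v] form a complete prefix code, and
    [prefix_code_sum] applies to the path of length 0 at [f(v)], which is a
    prefix of all of them; or [v] emits a single edge, which [f] contracts. *)
Lemma image_sum_real_ghost v : reg v ->
  \sum_(e <- fset_set (out v)) kmul (real (f (epath e))) (ghost (f (epath e)))
    = path_class (vertE (vmap f v)).
Proof.
move=> rv.
have vv : kmul (real (vpath (vmap f v))) (ghost (vpath (vmap f v)))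
    = path_class (vertE (vmap f v)).
  by rewrite real_vertex (vertex_mul_ghost (vpath _)) ghost_vertex.
have : regular_at f v \/ exists2 l, out v = [set l] & f (epath l) = f (vpath v).
  have [r0|nr0] := pselect (reg0 v); last by left; exact: (rm_reg f).1.
  have [|imf] := (rm_reg f).2 _ r0; first by left.
  have [_ [l [ol _]]] := r0; right; exists l => //.
  have : edge_image f v (f (epath l)) by exists l; rewrite ?ol.
  by rewrite imf.
case=> [rf|[l ol fl]]; last first.
  by rewrite ol fset_set1 big_seq_fset1 fl ph_vpath.
(* All the images start at [f(v)], so the filter keeps every term. *)
rewrite -vv; transitivity (\sum_(e <- fset_set (out v)
    | `[< prec (vpath (vmap f v)) (f (epath e)) >])
  kmul (real (f (epath e))) (ghost (f (epath e)))).
  rewrite [RHS]big_mkcond; apply: eq_big_seq => e.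
  move=> /(mem_out rv) ev; rewrite asboolT//; apply/precP.
  by rewrite ph_fsrc/= ev; split=> //; exists (fedges (f (epath e))).
have [e0 e0v] := rv.2.
apply: (@prefix_code_sum _ _ _ (fun e => f (epath e)) _ _ _ _ _ e0).
- exact: fset_uniq.
- by move=> e e' _ _; exact: rm_mono.
- move=> e e' /(mem_out rv) ev /(mem_out rv) e'v.
  by rewrite !ph_fsrc /= ev e'v.
- move=> e s1 x s2 x' /(mem_out rv) ev fs x'x.
  have [e' e'v fs'] := regular_at_branch rf ev fs x'x.
  by exists e' => //; exact/(mem_out rv).
- exact/(mem_out rv).
- apply/precP; rewrite ph_fsrc/= e0v; split=> //.
  by exists (fedges (f (epath e0))).
Qed.

Lemma leavitt_hom_exists : exists psi : kalg_hom (leavitt k E) (leavitt k F),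
  forall p, psi (path_class p) = path_class (ext_hom f p).
Proof.
pose phi := path_algebra_hom ext_hom_class_mul.
have phiU p : phi (chi k p) = path_class (ext_hom f p).
  exact: path_algebra_extU.
have [|psi psiE] := @leavitt_rec _ _ phi; last first.
  by exists psi => p; rewrite psiE phiU.
have lp := khom_linear phi.
move=> a [[[e e'] _ <-]|[v rv <-]].
  rewrite (linB lp) khom_mul !phiU !ext_hom_edge image_ghost_real.
  case: ifP => _; last by rewrite (lin0 lp) subr0.
  by rewrite phiU ext_hom_vertex subrr.
rewrite (linB lp) phiU ext_hom_vertex -(image_sum_real_ghost rv).
rewrite fsbig_finite; last exact: rv.1.
rewrite (lin_sum lp); apply/eqP; rewrite subr_eq0; apply/eqP.
by apply: eq_bigr => e _; rewrite khom_mul !phiU !ext_hom_edge.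
Qed.

Definition leavitt_hom : kalg_hom (leavitt k E) (leavitt k F) :=
  sval (cid leavitt_hom_exists).

Lemma leavitt_homE p : leavitt_hom (path_class p) = path_class (ext_hom f p).
Proof. by rewrite /leavitt_hom; case: cid. Qed.

Lemma leavitt_hom_unique (phi : kalg_hom (leavitt k E) (leavitt k F)) :
  (forall p, phi (path_class p) = path_class (ext_hom f p)) ->
  phi = leavitt_hom.
Proof.
move=> phiE; apply/kalg_hom_eq/funext/leavitt_linear_eq => [||p].
- exact: khom_linear.
- exact: khom_linear.
- by rewrite phiE leavitt_homE.
Qed.

End LeavittHom.

Definition leavitt_functor : functor (C := RMIPG) (D := KA k) (leavitt k).
Proof.
refine (@Functor RMIPG (KA k) (leavitt k) leavitt_hom _ _).
- move=> E; apply/esym/leavitt_hom_unique => p.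
  by rewrite ext_hom_id.
- move=> E F G g f; apply/esym/leavitt_hom_unique => p.
  by rewrite ext_hom_comp /= !leavitt_homE.
Defined.

(** * Units *)

Section Unit.

(* Classical equality and choice, so that vertices can index finite sums. *)
HB.instance Definition _ (E : graph) := gen_eqMixin (vert E).
HB.instance Definition _ (E : graph) := gen_choiceMixin (vert E).

(** The unit is the sum of the vertices: multiplying a path by it on the left or
    on the right leaves only the term of the source or of the target. *)
Lemma leavitt_unital (E : graph) : finite_set [set: vert E] ->
  unital (k := k) (leavitt k E).
Proof.
move=> fE; pose u : leavitt k E :=
  \sum_(v <- fset_set [set: vert E]) path_class (vertE v).
have memE (v : vert E) : v \in fset_set [set: vert E].
  by rewrite in_fset_set// inE.
exists u; split.
- apply: leavitt_linear_eq => [||p] //.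
    exact: kmul_linearr.
  rewrite (lin_sum (kmul_linearl _)) (bigD1_seq (fsrc p)) ?fset_uniq//=.
  rewrite path_class_mul// big1 ?addr0 => [|v /eqP vp].
    by rewrite (fvcat p).
  by rewrite path_class_mulE asboolF.
- suff ur : kmul^~ u =1 id by move=> x; exact: ur.
  apply: leavitt_linear_eq => [||p] //.
    exact: kmul_linearl.
  rewrite (lin_sum (kmul_linearr _)) (bigD1_seq (ftgt p)) ?fset_uniq//=.
  rewrite path_class_mul// big1 ?addr0 => [|v /eqP vp].
    by rewrite (fcatv p).
  by rewrite path_class_mulE asboolF// => /esym.
Qed.

End Unit.

(** Since every vertex of [F] is the image of a vertex of [E], the image of the
    unit fixes all vertices of [F], and thus all paths. *)
Lemma leavitt_hom_unital (E F : graph) (f : RMIPG_hom E F) :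
  bijective (vmap f) ->
  unital_hom (k := k) (A := leavitt k E) (B := leavitt k F) (leavitt_hom f).
Proof.
move=> [g _ gf] u [ul ur].
have imE w : path_class (vertE w) = leavitt_hom f (path_class (vertE (g w))).
  by rewrite leavitt_homE ext_hom_vertex gf.
split.
- apply: leavitt_linear_eq => [||p] //.
    exact: kmul_linearr.
  have <- : kmul (path_class (@vertE F (fsrc p))) (path_class p) = path_class p.
    by rewrite path_class_mul// (fvcat p).
  by rewrite kmulA imE -khom_mul ul.
- suff uR : kmul^~ (leavitt_hom f u) =1 id by move=> x; exact: uR.
  apply: leavitt_linear_eq => [||p] //.
    exact: kmul_linearl.
  have <- : kmul (path_class p) (path_class (@vertE F (ftgt p))) = path_class p.
    by rewrite path_class_mul// (fcatv p).
  by rewrite -kmulA imE -khom_mul ur.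
Qed.

Definition leavitt_unital_functor : functor (C := RMBPG) (D := UKA k)
  (fun E => exist _ (leavitt k (sval E)) (leavitt_unital (svalP E))).
Proof.
refine (@Functor RMBPG (UKA k)
  (fun E => exist _ (leavitt k (sval E)) (leavitt_unital (svalP E)))
  (fun E F f => exist _ (leavitt_hom (sval f)) (leavitt_hom_unital (svalP f)))
  _ _).
- by move=> E; apply: eq_exist; exact: (fmor_id leavitt_functor).
- by move=> E F G g f; apply: eq_exist; exact: (fmor_comp leavitt_functor).
Defined.

End Algebra.

Theorem theorem4p8 (k : fieldType) :
  exists L : functor (C := RMIPG) (D := KA k) (fun E => leavitt k E),
    (forall (E F : graph) (f : RMIPG_hom E F),
       (forall p : FP (ext E),
          (fmor L f : kalg_hom _ _) (leavitt_class (chi k p))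
            = leavitt_class (chi k (ext_hom f p))) /\
       (forall phi : kalg_hom (leavitt k E) (leavitt k F),
          (forall p : FP (ext E),
             phi (leavitt_class (chi k p))
               = leavitt_class (chi k (ext_hom f p))) ->
          phi = fmor L f)) /\
    exists (unitalL : forall E : RMBPG, unital (k := k) (leavitt k (sval E)))
           (U : functor (C := RMBPG) (D := UKA k)
                  (fun E => exist _ (leavitt k (sval E)) (unitalL E))),
      forall (E F : RMBPG) (f : arrow E F),
        sval (fmor U f) = fmor L (sval f).
Proof.
exists (leavitt_functor k); split=> [E F f|].
  by split; [exact: leavitt_homE|exact: leavitt_hom_unique].
exists (fun E => leavitt_unital k (svalP E)).
by exists (leavitt_unital_functor k).
Qed.
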